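(* There are absolute constants $C>0$ and $N_0$ such that the following holds for every $N\ge N_0$. Let $\{\phi_n\}_{n=1}^{N}$ be an orthonormal system on $\mathbb{T}$ such that $|\phi_n(x)|=1$ for all $x\in\mathbb{T}$ and all $n$, and let $a_1,\dots,a_N$ be complex numbers. Then there exists a permutation $\pi:[N]\to[N]$ such that $$\left\|\{a_{\pi(n)}\phi_{\pi(n)}\}_{n=1}^{N}\right\|_{L^2(V^2)}\le C\sqrt{\ln\ln(N)}\left(\sum_{n=1}^{N}|a_n|^2\right)^{1/2}.$$
   Context: $\mathbb{T}=[0,1]$ with Lebesgue measure, $[N]=\{1,\dots,N\}$. An orthonormal system is an ordered family of real or complex valued functions orthonormal in $L^2(\mathbb{T})$. For a finite sequence $b=(b_n)_{n=1}^{N}$ of complex numbers, $\|b\|_{V^2}=\sup_{\mathcal{P}}\left(\sum_{I\in\mathcal{P}}\left|\sum_{n\in I}b_n\right|^2\right)^{1/2}$, the supremum being over all partitions $\mathcal{P}$ of $[N]$ into disjoint subintervals. For functions $g_1,\dots,g_N$ on $\mathbb{T}$, $\|\{g_n\}_{n=1}^{N}\|_{L^2(V^2)}$ is the $L^2(\mathbb{T})$ norm of $x\mapsto\|\{g_n(x)\}_{n=1}^{N}\|_{V^2}$. *)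

(* Defs.v *)
(* MathComp-Analysis, with the complex numbers R[i] of mathcomp-real-closed. *)
From HB Require Import structures.
From mathcomp Require Export all_boot all_order all_algebra perm.
From mathcomp Require Export all_classical all_reals all_analysis.
From mathcomp Require Export complex.

Set Implicit Arguments.
Unset Strict Implicit.
Unset Printing Implicit Defensive.

Import Order.TTheory GRing.Theory Num.Theory.

Local Open Scope classical_set_scope.
Local Open Scope ring_scope.

(* The modulus of a complex number as an element of R: the generic norm
   `|z| of R[i] lives in R[i] and equals (cmod z)%:C. *)
Notation cmod := Normc.normc.

Section V2.
Context {R : realType} {N : nat}.

(* 'I_N = {0, ..., N-1} stands for [N] = {1, ..., N}. *)
Definition ord_interval (I : {set 'I_N}) : bool :=
  [forall i in I, forall j in I, forall k : 'I_N,
     (i <= k <= j)%N ==> (k \in I)].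

Definition interval_partition (P : {set {set 'I_N}}) : bool :=
  finset.partition P [set: 'I_N]%SET && [forall I in P, ord_interval I].

Definition V2norm (b : 'I_N -> R[i]) : R :=
  sup [set Num.sqrt (\sum_(I in P) cmod (\sum_(n in I) b n) ^+ 2)
      | P in [set P : {set {set 'I_N}} | interval_partition P]].

End V2.

Section L2.
Context {d : measure_display} {T : measurableType d} {R : realType}.
Variables (mu : {measure set T -> \bar R}) (D : set T).

Definition complex_measurable (f : T -> R[i]) : Prop :=
  measurable_fun D (fun x => complex.Re (f x)) /\
  measurable_fun D (fun x => complex.Im (f x)).

Definition in_L2 (f : T -> R[i]) : Prop :=
  complex_measurable f /\
  (\int[mu]_(x in D) (cmod (f x) ^+ 2)%:E < +oo)%E.

(* Integrals here are real-valued and total; for f and g in L2 the integrands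
   are integrable, so that nothing is hidden by the convention fine +oo = 0. *)
Definition L2inner (f g : T -> R[i]) : R[i] :=
  Complex (\int[mu]_(x in D) complex.Re (f x * (g x)^*%C))
          (\int[mu]_(x in D) complex.Im (f x * (g x)^*%C)).

Definition orthonormal_system (N : nat) (phi : 'I_N -> T -> R[i]) : Prop :=
  (forall n, in_L2 (phi n)) /\
  (forall m n, L2inner (phi m) (phi n) = (m == n)%:R).

Definition L2V2norm (N : nat) (g : 'I_N -> T -> R[i]) : \bar R :=
  sqrte (\int[mu]_(x in D) (V2norm (fun n => g n x) ^+ 2)%:E)%E.

End L2.

(* The completed measure is used so that measurable means Lebesgue measurable
   rather than Borel measurable. Its carrier is convertible to R. *)
Notation lebesgue R := (@completed_lebesgue_measure R).

(* Main.v *)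
Require Import Defs.
From mathcomp Require Import ring lra zify measurable_realfun.

Set Implicit Arguments.
Unset Strict Implicit.
Unset Printing Implicit Defensive.

Import Order.TTheory GRing.Theory Num.Theory.

Local Open Scope ring_scope.

(** A uniformly random permutation works on average. Write E for the average
    over all permutations s of 'I_N. The core is a pointwise estimate for an
    arbitrary sequence z of N complex numbers with sum S and with
    \sum |z_n|^2 <= Q, when N is large:

      E ||z o s||_{V^2}^2 <= 6 |S|^2 + C ln(ln N) Q     (permE_V2norm_sqr).

    Applied to z_n = a_n phi_n(x) and integrated in x, it gives the theorem:
    |z_n| = |a_n|, the integral of |S|^2 is \sum |a_n|^2 by orthonormality, and
    some permutation does at least as well as the average.

    Taking real and imaginary parts, it is enough to bound
    \sum_I (\sum_(t in I) b (s t))^2 for a real sequence b and for all interval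
    partitions at once. Put lam = r^2 = 2 ln(ln N). An interval I belongs to the
    scale j when 2^j <= |I| < 2^(j+1); let rho_j = 2^j / N. At the scale j the
    sequence b is truncated at height sqrt(rho_j Q / lam), so that the sum over
    I splits into three parts.

    - The high part. The square of its sum over I is at most the diagonal, which
      adds up to Q over a partition, plus off-diagonal products of pairs of
      positions at distance less than 2^(j+1). The latter are rare: their
      expectation is at most 4 \sum_j rho_j (\sum_n |high_j n|)^2, which is
      O(lam Q) by a geometric summation over j (high_energy_le).

    - The mean of the low part, |I|/N times its total: this is controlled by S
      and again by the high part, because low = b - high.

    - The fluctuation of the low part. Prefix sums of a randomly permuted
      centered sequence, divided by the number of positions not yet used, form a
      martingale, so that Doob's inequality for exponentials bounds the maximal
      prefix sum in a window of length O(2^j) by its terminal value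
      (permE_doob). The latter has Gaussian exponential moments, because the
      truncation makes the relevant exponents bounded, and because products
      sampled without replacement are dominated by independent ones
      (permE_prod_le). Hence the squared fluctuation over I is at most
      C rho_j Q (lam + X), with E X = O(exp(- lam / 2)) = O(1 / ln N). The term
      with lam adds up to O(lam Q) over a partition, since rho_j <= |I| / N; the
      excesses X are summed over all windows and over the O(ln N) scales, and
      contribute O(Q).

    The window attached to I is centered at any of the positions of I, and the
    bound is averaged over these positions. In this way the bound for I becomes
    a sum over t in I of a quantity which depends on t and s only
    (interval_sum_le), and this sums trivially over a partition. *)

(** * Averages over permutations *)

Section PermutationAverage.
Context {R : realType} {N : nat}.
Implicit Types (F G : {perm 'I_N} -> R) (f c : 'I_N -> R) (s : {perm 'I_N}).

(** The average of F over all permutations of 'I_N. *)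
Definition permE F : R := (N`!)%:R^-1 * \sum_s F s.

Lemma permE_sum (I : Type) (r : seq I) (P : pred I) (K : I -> {perm 'I_N} -> R) :
  permE (fun s => \sum_(i <- r | P i) K i s) = \sum_(i <- r | P i) permE (K i).
Proof. by rewrite /permE exchange_big /= mulr_sumr. Qed.

Lemma permED F G : permE (fun s => F s + G s) = permE F + permE G.
Proof. by rewrite /permE big_split /= mulrDr. Qed.

Lemma permEZ (a : R) F : permE (fun s => a * F s) = a * permE F.
Proof. by rewrite /permE -mulr_sumr mulrCA. Qed.

Lemma permE_cst (a : R) : permE (fun=> a) = a.
Proof.
rewrite /permE sumr_const card_Sn -[a *+ _]mulr_natl mulrA.
by rewrite mulVf ?mul1r// pnatr_eq0 -lt0n fact_gt0.
Qed.

Lemma ler_permE F G : (forall s, F s <= G s) -> permE F <= permE G.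
Proof.
by move=> FG; rewrite /permE ler_wpM2l ?invr_ge0 ?ler0n// ler_sum.
Qed.

Lemma eq_permE F G : (forall s, F s = G s) -> permE F = permE G.
Proof. by move=> FG; rewrite /permE (eq_bigr _ (fun s _ => FG s)). Qed.

Lemma permE_tperm (i j : 'I_N) F :
  permE F = permE (fun s => F (tperm i j * s)%g).
Proof. by rewrite /permE (reindex_inj (mulgI (tperm i j))). Qed.

Lemma sum_perm f s : \sum_i f (s i) = \sum_i f i.
Proof. by rewrite [RHS](reindex_inj (@perm_inj _ s)). Qed.

(** Sampling without replacement: the expectation of a product of nonnegative
    values at distinct positions is at most the product of the expectations
    (a form of the Maclaurin inequality). *)
Lemma permE_prod_le f (A : {set 'I_N}) : (0 < N)%N -> (forall i, 0 <= f i) ->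
  permE (fun s => \prod_(i in A) f (s i)) <= (N%:R^-1 * \sum_i f i) ^+ #|A|.
Proof.
move=> N0 f0; have [n] := ubnP #|A|; elim: n A => // n IH A An.
have [->|[j jA]] := set_0Vmem A.
  rewrite cards0 expr0 -[leRHS]permE_cst; apply: ler_permE => s.
  by rewrite big_set0.
pose B := (A :\ j)%SET; pose g s := \prod_(i in B) f (s i).
have g0 s : 0 <= g s by apply: prodr_ge0.
have jB : j \notin B by rewrite !inE eqxx.
have cA : #|A| = #|B|.+1 by rewrite (cardsD1 j) jA.
have -> : permE (fun s => \prod_(i in A) f (s i)) = permE (fun s => g s * f (s j)).
  by apply: eq_permE => s; rewrite (big_setD1 j)//= mulrC.
(* Multiplying by the value at a position of B can only do better than at the
   new position j: exchange i and j and use 2 f_i f_j <= f_i^2 + f_j^2. *)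
have key i : permE (fun s => g s * f (s j)) <= permE (fun s => g s * f (s i)).
  have [iB|iB] := boolP (i \in B); last first.
    rewrite (permE_tperm i j) (@eq_permE _ (fun s => g s * f (s i)))// => s.
    rewrite permM tpermR /g; congr (_ * _); apply: eq_bigr => k kB.
    by rewrite permM tpermD//; [apply: contraNneq iB | apply: contraNneq jB] => ->.
  pose h s := \prod_(k in (B :\ i)%SET) f (s k).
  have h0 s : 0 <= h s by apply: prodr_ge0.
  have ij : i != j by apply: contraNneq jB => <-.
  have gE s : g s = h s * f (s i) by rewrite /g (big_setD1 i)//= mulrC.
  have hE s : h (tperm i j * s)%g = h s.
    apply: eq_bigr => k; rewrite !inE => /and3P[ki kj _].
    by rewrite permM tpermD// eq_sym.
  have E1 : permE (fun s => g s * f (s i)) = permE (fun s => h s * f (s j) ^+ 2).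
    rewrite (permE_tperm i j); apply: eq_permE => s.
    by rewrite gE hE permM tpermL expr2 mulrA.
  have E2 : permE (fun s => g s * f (s i)) = permE (fun s => h s * f (s i) ^+ 2).
    by apply: eq_permE => s; rewrite gE expr2 mulrA.
  rewrite -subr_ge0 -(@pmulr_rge0 _ 2)// mulrBr [in X in X - _]mulr2n mulrDl !mul1r.
  rewrite {1}E1 E2 -permED -permEZ -[- _]mulN1r -permEZ -permED.
  rewrite -[0](permE_cst 0); apply: ler_permE => s; rewrite gE.
  have := h0 s; have := sqr_ge0 (f (s i) - f (s j)); nra.
rewrite cA exprSr.
apply: (@le_trans _ _ (permE g * (N%:R^-1 * \sum_i f i))); last first.
  rewrite ler_wpM2r ?mulr_ge0 ?invr_ge0 ?sumr_ge0//.
  by apply: IH; rewrite -ltnS -cA.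
have NR : (0 : R) < N%:R by rewrite ltr0n.
rewrite mulrCA -(ler_pM2l NR) [leRHS]mulrA divff ?gt_eqF// mul1r.
rewrite [leRHS]mulrC -[leRHS]permEZ.
have -> : permE (fun s => (\sum_i f i) * g s) = \sum_i permE (fun s => g s * f (s i)).
  rewrite -permE_sum; apply: eq_permE => s.
  by rewrite -(sum_perm f s) mulrC mulr_sumr.
by rewrite -[N in N%:R]card_ord mulr_natl -sumr_const ler_sum.
Qed.

End PermutationAverage.

(** * Doob's inequality for prefix sums of a permuted sequence *)

Section RunningMax.
Context {R : realType}.
Implicit Types g : nat -> R.

(** The maximum of g 0, ..., g m. *)
Fixpoint runmax g (m : nat) : R :=
  if m is k.+1 then Num.max (runmax g k) (g k.+1) else g 0%N.

Lemma le_runmax g (k m : nat) : (k <= m)%N -> g k <= runmax g m.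
Proof.
elim: m => [|m IH]; first by rewrite leqn0 => /eqP ->.
rewrite leq_eqVlt => /orP[/eqP ->|km] /=; rewrite le_max ?lexx ?orbT//.
by rewrite IH.
Qed.

Lemma eq_runmax g h (m : nat) : (forall k, (k <= m)%N -> g k = h k) ->
  runmax g m = runmax h m.
Proof.
elim: m => [|m IH] gh /=; first exact: gh.
by rewrite IH ?gh// => k km; rewrite gh// ltnW.
Qed.

(** A deterministic form of Doob's L^2 maximal inequality: for a submartingale
    the sum on the right has a nonnegative expectation. *)
Lemma doob_pathwise g (m : nat) :
  runmax g m ^+ 2 <=
  4 * g m ^+ 2 - 4 * \sum_(k < m) runmax g k * (g k.+1 - g k).
Proof.
suff H : runmax g m ^+ 2 / 2 <=
    runmax g m * g m - \sum_(k < m) runmax g k * (g k.+1 - g k).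
  have := sqr_ge0 (runmax g m - 2 * g m); nra.
elim: m => [|m IH] /=; first by rewrite big_ord0; have := sqr_ge0 (g 0%N); nra.
rewrite big_ord_recr /=; move: IH.
set S := \sum_(_ < _) _; set G := runmax g m => IH.
case: (leP (g m.+1) G) => gG; first nra.
have := sqr_ge0 (g m.+1 - G); nra.
Qed.

End RunningMax.

Section PrefixSums.
Context {R : realType} {N : nat}.
Variables (c : 'I_N -> R) (H : {set 'I_N}).
Implicit Types (s : {perm 'I_N}) (k : nat).

(** The positions of H that come before k. *)
Definition prefix k : {set 'I_N} := [set i in H | (i < k)%N]%SET.

Definition prefix_sum s k : R := \sum_(i in prefix k) c (s i).

(** The martingale attached to the prefix sums: when c has mean zero, this is
    minus the average of the values at the positions outside prefix k. *)
Definition prefix_mart s k : R := prefix_sum s k / (N%:R - #|prefix k|%:R).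

Lemma prefixN : prefix N = H.
Proof. by apply/setP => i; rewrite inE ltn_ord andbT. Qed.

(** If F does not change when k is exchanged with a position outside A, then all
    the positions outside A look alike to F; their values sum to minus the sum
    over A. *)
Lemma permE_swap (A : {set 'I_N}) (k : 'I_N) (F : {perm 'I_N} -> R) :
  \sum_i c i = 0 ->
  (forall j s, j \notin A -> F (tperm k j * s)%g = F s) ->
  permE (fun s => F s * ((N%:R - #|A|%:R) * c (s k) + \sum_(i in A) c (s i))) = 0.
Proof.
move=> c0 FA.
have E j : j \notin A -> permE (fun s => F s * c (s j)) = permE (fun s => F s * c (s k)).
  move=> jA; rewrite (permE_tperm k j); apply: eq_permE => s.
  by rewrite FA// permM tpermR.
have -> : N%:R - #|A|%:R = #|(~: A)%SET|%:R :> R.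
  by rewrite -{1}[N]card_ord -(cardsC A) natrD addrC addKr.
rewrite (@eq_permE _ _ _ (fun s => #|(~: A)%SET|%:R * (F s * c (s k)) +
    \sum_(i in A) F s * c (s i))); last first.
  by move=> s; rewrite mulrDr mulrCA mulr_sumr.
rewrite permED permEZ.
have -> : #|(~: A)%SET|%:R * permE (fun s => F s * c (s k)) =
    permE (fun s => \sum_(i in (~: A)%SET) F s * c (s i)).
  rewrite permE_sum mulr_natl -sumr_const; apply: eq_bigr => j.
  by rewrite inE => /E ->.
rewrite -permED -[RHS](permE_cst (N := N)); apply: eq_permE => s.
rewrite (eq_bigl (fun i => i \notin A)); last by move=> i; rewrite inE.
transitivity (\sum_i F s * c (s i)); first by rewrite [RHS](bigID (mem A)) /= addrC.
by rewrite -mulr_sumr sum_perm c0 mulr0.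
Qed.

Hypothesis c0 : \sum_i c i = 0.
Hypothesis HN : (#|H| < N)%N.

Lemma prefix_gap_gt0 k : (0 : R) < N%:R - #|prefix k|%:R.
Proof.
rewrite subr_gt0 ltr_nat (leq_ltn_trans _ HN)//; apply: subset_leq_card.
by apply/fintype.subsetP => i; rewrite inE => /andP[].
Qed.

Lemma prefixS (k : 'I_N) : k \in H -> prefix k.+1 = (k |: prefix k)%SET.
Proof.
move=> kH; apply/setP => i; rewrite !inE ltnS leq_eqVlt.
by have [->|ik] := eqVneq i k; rewrite ?eqxx ?kH//= (negbTE (_ : val i != val k)).
Qed.

Lemma prefixSN (k : 'I_N) : k \notin H -> prefix k.+1 = prefix k.
Proof.
move=> kH; apply/setP => i; rewrite !inE ltnS leq_eqVlt.
by have [->|ik] := eqVneq i k; rewrite ?(negbTE kH)//= (negbTE (_ : val i != val k)).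
Qed.

Lemma prefix_martS s (k : 'I_N) : k \in H ->
  prefix_mart s k.+1 - prefix_mart s k =
  ((N%:R - #|prefix k|%:R) * (N%:R - #|prefix k.+1|%:R))^-1 *
  ((N%:R - #|prefix k|%:R) * c (s k) + prefix_sum s k).
Proof.
move=> kH; have := prefix_gap_gt0 k.+1; have := prefix_gap_gt0 k.
have kp : k \notin prefix k by rewrite inE ltnn andbF.
rewrite /prefix_mart /prefix_sum prefixS// cardsU1 kp big_setU1//=.
rewrite -/(prefix_sum s k) add1n -natr1 => n0 n1.
by field; rewrite ?gt_eqF.
Qed.

Lemma prefix_sum_tperm (k j : 'I_N) s i : (i <= k)%N -> j \notin prefix k ->
  prefix_sum (tperm k j * s)%g i = prefix_sum s i.
Proof.
move=> ik jk; apply: eq_bigr => l; rewrite inE => /andP[lH li].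
rewrite permM tpermD//.
  by apply: contraTneq li => <-; rewrite -leqNgt.
by apply: contraNneq jk => ->; rewrite inE lH (leq_trans li).
Qed.

(** Doob's inequality for the submartingale exp(gamma * prefix_mart). *)
Lemma permE_doob (gamma : R) :
  permE (fun s => runmax (fun k => expR (gamma * prefix_mart s k)) N ^+ 2) <=
  4 * permE (fun s => expR (gamma * prefix_mart s N) ^+ 2).
Proof.
pose g s k := expR (gamma * prefix_mart s k).
suff step (k : 'I_N) : 0 <= permE (fun s => runmax (g s) k * (g s k.+1 - g s k)).
  rewrite -subr_ge0 -permEZ -[- _]mulN1r -permEZ -permED.
  apply: (@le_trans _ _ (4 * \sum_(k < N) permE (fun s =>
     runmax (g s) k * (g s k.+1 - g s k)))).
    by rewrite mulr_ge0// sumr_ge0.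
  rewrite -permE_sum -permEZ; apply: ler_permE => s.
  by have := doob_pathwise (g s) N; rewrite /g; lra.
have g0 s i : 0 < g s i by exact: expR_gt0.
have [kH|kH] := boolP (k \in H); last first.
  rewrite -[leLHS](permE_cst (N := N)); apply: ler_permE => s.
  by rewrite /g /prefix_mart /prefix_sum prefixSN// subrr mulr0.
pose F s := runmax (g s) k * g s k.
have FE j s : j \notin prefix k -> F (tperm k j * s)%g = F s.
  move=> jk; have E i : (i <= k)%N -> g (tperm k j * s)%g i = g s i.
    by move=> ik; rewrite /g /prefix_mart prefix_sum_tperm.
  by rewrite /F E// (eq_runmax E).
pose K : R := gamma * ((N%:R - #|prefix k|%:R) * (N%:R - #|prefix k.+1|%:R))^-1.
have <- : permE (fun s => K * (F s * ((N%:R - #|prefix k|%:R) * c (s k) + prefix_sum s k))) = 0.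
  by rewrite permEZ (permE_swap c0 FE) mulr0.
apply: ler_permE => s.
have -> : K * (F s * ((N%:R - #|prefix k|%:R) * c (s k) + prefix_sum s k)) =
   runmax (g s) k * (g s k * (gamma * (prefix_mart s k.+1 - prefix_mart s k))).
  by rewrite prefix_martS// /K /F; ring.
rewrite ler_wpM2l//; first by apply: ltW; apply: lt_le_trans (le_runmax (g s) (leqnn k)).
have -> : g s k.+1 = g s k * expR (gamma * (prefix_mart s k.+1 - prefix_mart s k)).
  by rewrite /g -expRD -mulrDr addrC subrK.
have := expR_ge1Dx (gamma * (prefix_mart s k.+1 - prefix_mart s k)).
have := g0 s k; nra.
Qed.

End PrefixSums.

(** * Exponential moments of prefix sums *)

Section ExponentialMoments.
Context {R : realType} {N : nat}.
Implicit Types (c : 'I_N -> R) (A H : {set 'I_N}).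

Lemma expR_le_quadratic (x : R) : `|x| <= 1 / 2 -> expR x <= 1 + x + 2 * x ^+ 2.
Proof.
rewrite ler_norml => /andP[x1 x2].
have h : 0 < 1 - x by lra.
have := expR_ge1Dx (- x); rewrite expRN => e1.
have e0 := expR_gt0 x.
have : expR x * (1 - x) <= 1.
  by rewrite -[leRHS](@mulfV _ (expR x)) ?gt_eqF// ler_pM2l.
have : 0 <= x ^+ 2 * (1 - 2 * x) by rewrite mulr_ge0 ?sqr_ge0//; lra.
by move=> a1 a2; rewrite -(ler_pM2r h); nra.
Qed.

(** A Gaussian bound for the exponential moments of a sum over a random sample. *)
Lemma permE_expR c A (theta Q : R) : (0 < N)%N -> \sum_i c i = 0 ->
  \sum_i c i ^+ 2 <= Q -> (forall i, `|theta * c i| <= 1 / 2) ->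
  permE (fun s => expR (theta * \sum_(i in A) c (s i))) <=
  expR (2 * theta ^+ 2 * Q / N%:R * #|A|%:R).
Proof.
move=> N0 c0 cQ ct; have NR : (0 : R) < N%:R by rewrite ltr0n.
rewrite (@eq_permE _ _ _ (fun s => \prod_(i in A) expR (theta * c (s i)))); last first.
  by move=> s; rewrite mulr_sumr expR_sum.
apply: le_trans (@permE_prod_le _ _ (fun i => expR (theta * c i)) A N0 _) _.
  by move=> i; exact: expR_ge0.
rewrite expRM_natr lerXn2r// ?nnegrE ?expR_ge0//.
  by rewrite mulr_ge0 ?invr_ge0 ?ler0n// sumr_ge0// => i _; exact: expR_ge0.
apply: le_trans (expR_ge1Dx _).
apply: (@le_trans _ _ (N%:R^-1 * \sum_i (1 + theta * c i + 2 * (theta * c i) ^+ 2))).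
  by rewrite ler_wpM2l ?invr_ge0 ?ler0n// ler_sum// => i _; exact: expR_le_quadratic.
rewrite !big_split /= sumr_const card_ord -mulr_sumr c0 mulr0 addr0.
rewrite -mulr_sumr (eq_bigr (fun i => theta ^+ 2 * c i ^+ 2)); last first.
  by move=> i _; rewrite exprMn.
rewrite -mulr_sumr mulrDr mulVf ?gt_eqF// lerD2l mulrC ler_wpM2r ?invr_ge0 ?ler0n//.
by rewrite -mulrA ler_wpM2l// ler_wpM2l// sqr_ge0.
Qed.

(** A majorant of exp(theta |prefix sum|), uniform over all prefixes, for
    gamma = N * theta / 2; see prefix_exp_ge. *)
Definition prefix_exp c H (gamma : R) (s : {perm 'I_N}) : R :=
  runmax (fun k => expR (gamma * prefix_mart c H s k)) N ^+ 2 +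
  runmax (fun k => expR (- gamma * prefix_mart c H s k)) N ^+ 2.

Lemma prefix_exp_ge c H (theta : R) s k : (0 < N)%N -> (#|H| < N)%N -> 0 <= theta ->
  (k <= N)%N ->
  expR (theta * `|prefix_sum c H s k|) <= prefix_exp c H (N%:R * theta / 2) s.
Proof.
move=> N0 HN t0 kN; have NR : (0 : R) < N%:R by rewrite ltr0n.
have gap := prefix_gap_gt0 (R := R) HN k.
have E : theta * `|prefix_sum c H s k| <=
    2 * ((N%:R * theta / 2) * `|prefix_mart c H s k|).
  rewrite [leRHS](_ : _ = theta * (N%:R * `|prefix_mart c H s k|)); last by field.
  rewrite ler_wpM2l// /prefix_mart normrM normfV (gtr0_norm gap).
  rewrite mulrCA ler_peMr// ler_pdivlMr// mul1r lerBlDl lerDr ler0n//.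
apply: (@le_trans _ _ (expR (N%:R * theta / 2 * `|prefix_mart c H s k|) ^+ 2)).
  by rewrite -expRM_natl ler_expR.
set y := prefix_mart c H s k; rewrite /prefix_exp.
have [y0|y0] := leP 0 y.
  rewrite ger0_norm//.
  apply: (@le_trans _ _ (runmax (fun k => expR (N%:R * theta / 2 * prefix_mart c H s k)) N ^+ 2)).
    rewrite lerXn2r ?nnegrE ?expR_ge0//.
      by apply: le_trans (le_runmax _ kN); exact: expR_ge0.
    exact: (le_runmax (fun k => expR (N%:R * theta / 2 * prefix_mart c H s k)) kN).
  by rewrite lerDl sqr_ge0.
rewrite ltr0_norm//.
apply: (@le_trans _ _ (runmax (fun k => expR (- (N%:R * theta / 2) * prefix_mart c H s k)) N ^+ 2)).
  rewrite lerXn2r ?nnegrE ?expR_ge0//.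
    by apply: le_trans (le_runmax _ kN); exact: expR_ge0.
  rewrite mulrN -mulNr.
  exact: (le_runmax (fun k => expR (- (N%:R * theta / 2) * prefix_mart c H s k)) kN).
by rewrite lerDr sqr_ge0.
Qed.

(** The set H must leave a third of the positions free, so that the denominators
    of the martingale stay comparable to N. *)
Lemma permE_prefix_exp c H (theta Q : R) : (0 < N)%N -> (3 * #|H| <= 2 * N)%N ->
  0 <= theta -> \sum_i c i = 0 -> \sum_i c i ^+ 2 <= Q ->
  (forall i, `|6 * theta * c i| <= 1) ->
  permE (prefix_exp c H (N%:R * theta / 2)) <=
  8 * expR (18 * theta ^+ 2 * Q / N%:R * #|H|%:R).
Proof.
move=> N0 H23 t0 c0 cQ ct; have NR : (0 : R) < N%:R by rewrite ltr0n.
have HN : (#|H| < N)%N by lia.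
have Q0 : 0 <= Q by apply: le_trans cQ; apply: sumr_ge0 => i _; exact: sqr_ge0.
have gap := prefix_gap_gt0 (R := R) HN N; rewrite prefixN in gap.
have gap3 : N%:R <= 3 * (N%:R - #|H|%:R) :> R.
  have : (3 * #|H|)%:R <= (2 * N)%:R :> R by rewrite ler_nat.
  by rewrite !natrM; lra.
have main (sg : R) : `|sg| = 1 ->
    permE (fun s => expR (sg * (N%:R * theta / 2) * prefix_mart c H s N) ^+ 2) <=
    expR (18 * theta ^+ 2 * Q / N%:R * #|H|%:R).
  move=> sg1; pose th := sg * theta * (N%:R / (N%:R - #|H|%:R)).
  have r0 : 0 <= N%:R / (N%:R - #|H|%:R) :> R by rewrite divr_ge0// ltW.
  have r3 : N%:R / (N%:R - #|H|%:R) <= 3 :> R by rewrite ler_pdivrMr.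
  rewrite (@eq_permE _ _ _ (fun s => expR (th * \sum_(i in H) c (s i)))); last first.
    move=> s; rewrite -expRM_natl /prefix_mart /prefix_sum prefixN; congr expR.
    by rewrite /th; field; rewrite gt_eqF.
  apply: le_trans (permE_expR _ N0 c0 cQ _) _.
    move=> i; rewrite /th normrM normrM normrM sg1 mul1r (ger0_norm t0) (ger0_norm r0).
    have := ct i; rewrite !normrM (ger0_norm t0) (ger0_norm (ler0n _ 6)) => ct'.
    have : theta * `|c i| * (N%:R / (N%:R - #|H|%:R)) <= theta * `|c i| * 3.
      by rewrite ler_wpM2l// mulr_ge0.
    by rewrite [leLHS]mulrAC; lra.
  rewrite ler_expR ler_wpM2r ?ler0n// ler_wpM2r ?invr_ge0 ?ler0n// ler_wpM2r//.
  have -> : th ^+ 2 = theta ^+ 2 * (N%:R / (N%:R - #|H|%:R)) ^+ 2.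
    by rewrite /th !exprMn -(real_normK (num_real sg)) sg1 expr1n mul1r.
  have : (N%:R / (N%:R - #|H|%:R)) ^+ 2 <= 9 :> R by nra.
  have := sqr_ge0 theta; nra.
rewrite /prefix_exp permED.
have := permE_doob c0 HN (N%:R * theta / 2).
have := permE_doob c0 HN (- (N%:R * theta / 2)).
have := main 1 (normr1 _); have := main (-1) (normrN1 _).
rewrite mul1r mulN1r; lra.
Qed.

End ExponentialMoments.

(** * Intervals of positions and dyadic scales *)

Lemma card_ord_between (N a b : nat) :
  (#|[set t : 'I_N | (a <= t < b)%N]%SET| = minn b N - a)%N.
Proof.
rewrite -sum1_card (eq_bigl (fun t : 'I_N => (a <= t < b)%N)); last first.
  by move=> t; rewrite inE.
rewrite -(big_mkord (fun t => (a <= t < b)%N) (fun=> 1%N)).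
rewrite (eq_bigl (fun t => (t < b)%N && (a <= t)%N)); last by move=> t; rewrite andbC.
have [bN|Nb] := leqP b N.
  rewrite -[RHS]muln1 -sum_nat_const_nat [RHS](big_nat_widenl _ 0)//.
  by rewrite [RHS](big_nat_widen _ _ N)//; apply: eq_bigl => t; rewrite andbC.
rewrite -[RHS]muln1 -sum_nat_const_nat [RHS](big_nat_widenl _ 0)//.
rewrite big_nat_cond [RHS]big_nat_cond; apply: eq_bigl => t.
by case: (ltnP t N) => tN; rewrite ?andbF//= (ltn_trans tN Nb).
Qed.

Lemma ord_intervalP (N : nat) (I : {set 'I_N}) (i : 'I_N) : ord_interval I -> i \in I ->
  exists a b : nat, [/\ (b <= N)%N, (a <= b)%N & I = [set t : 'I_N | (a <= t < b)%N]%SET].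
Proof.
move=> /forall_inP HI iI.
case: (arg_minnP (fun t : 'I_N => val t) iI) => x xI xmin.
case: (arg_maxnP (fun t : 'I_N => val t) iI) => y yI ymax.
exists x, y.+1; split; first exact: ltn_ord.
  by rewrite leqW// xmin.
apply/setP => t; rewrite inE ltnS; apply/idP/idP => [tI|xty].
  by rewrite xmin//=; apply: ymax.
by move: (HI _ xI) => /forall_inP/(_ _ yI)/forallP/(_ t)/implyP; apply.
Qed.

Lemma sum_pow2_lt {R : realType} (y : R) (m : nat) : 0 <= y ->
  \sum_(j < m | 2 ^+ j < y) 2 ^+ j <= 2 * y.
Proof.
move=> y0; rewrite big_mkcond /=.
elim: m => [|m IH]; first by rewrite big_ord0 mulr_ge0.
rewrite big_ord_recr /=; case: ifPn => [my|_]; last by rewrite addr0.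
have H k : \sum_(j < k) (2 ^+ j : R) = 2 ^+ k - 1.
  elim: k => [|k IHk]; first by rewrite big_ord0 expr0 subrr.
  by rewrite big_ord_recr /= IHk exprS; ring.
apply: (@le_trans _ _ (2 ^+ m - 1 + 2 ^+ m)); last by lra.
rewrite lerD2r -H ler_sum// => j _; case: ifP => // _; exact: exprn_ge0.
Qed.

(** * Truncation and the three parts of a sum over an interval *)

Section VariationBound.
Context {R : realType} {N : nat}.
Variables (b : 'I_N -> R) (Q r : R).
Hypotheses (N1 : (1 < N)%N) (Q0 : 0 < Q) (bQ : \sum_i b i ^+ 2 <= Q) (r1 : 1 <= r).
Implicit Types (s : {perm 'I_N}) (j : nat) (i t n : 'I_N).

(** The length 2^j as a fraction of N. *)
Definition scale j : R := 2 ^+ j / N%:R.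
(** The truncation: light means |b n| <= sqrt (scale j * Q) / r. *)
Definition light j n : bool := b n ^+ 2 * r ^+ 2 <= scale j * Q.
Definition low j n : R := if light j n then b n else 0.
Definition high j n : R := if light j n then 0 else b n.
Definition low_mean j : R := (\sum_n low j n) / N%:R.
(** The low part, recentered to have mean zero. *)
Definition centered j n : R := low j n - low_mean j.
Definition high_mass j : R := \sum_n `|high j n|.

(** The positions at distance less than 2^(j+1) from i which lie in the first
    half of 'I_N if p = true, in the second half if p = false. Cutting into halves
    keeps every window, at every scale, within two thirds of the positions, as
    permE_prefix_exp requires. *)
Definition window j i (p : bool) : {set 'I_N} :=
  [set t : 'I_N | (i < t + 2 ^ j.+1)%N && (t < i + 2 ^ j.+1)%N && ((t < N./2)%N == p)]%SET.

(** The exponent of the exponential moments at the scale j; the constant 12 makes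
    |6 * rate j * centered j n| <= 1. *)
Definition rate j : R := r / (12 * Num.sqrt (scale j * Q)).
(** The exponential majorant of the prefix sums in a window. *)
Definition excess j i p s : R :=
  prefix_exp (centered j) (window j i p) (N%:R * rate j / 2) s.

Let NR : (0 : R) < N%:R. Proof. by rewrite ltr0n ltnW. Qed.
Let r_gt0 : 0 < r. Proof. exact: lt_le_trans ltr01 r1. Qed.

Lemma scale_gt0 j : 0 < scale j.
Proof. by rewrite divr_gt0// exprn_gt0. Qed.

Let sd_gt0 j : 0 < Num.sqrt (scale j * Q).
Proof. by rewrite sqrtr_gt0 mulr_gt0// scale_gt0. Qed.

Let sd2 j : Num.sqrt (scale j * Q) ^+ 2 = scale j * Q.
Proof. by rewrite sqr_sqrtr// mulr_ge0 ?ltW// scale_gt0. Qed.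

Lemma rate_ge0 j : 0 <= rate j.
Proof. exact: divr_ge0 (ltW r_gt0) (mulr_ge0 (ler0n _ 12) (ltW (sd_gt0 j))). Qed.

Lemma low_high j n : b n = high j n + low j n.
Proof. by rewrite /high /low; case: ifP; rewrite ?add0r ?addr0. Qed.

Lemma sum_centered j : \sum_n centered j n = 0.
Proof.
rewrite /centered big_split /= sumr_const card_ord /low_mean.
by rewrite -[X in _ + X]mulr_natl mulrN mulrCA divff ?gt_eqF// mulr1 subrr.
Qed.

Lemma sum_sqr_centered j : \sum_n centered j n ^+ 2 <= Q.
Proof.
apply: le_trans bQ; apply: (@le_trans _ _ (\sum_n low j n ^+ 2)); last first.
  apply: ler_sum => n _; rewrite /low; case: ifP => // _.
  by rewrite expr0n sqr_ge0.
have E n : centered j n ^+ 2 =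
    low j n ^+ 2 - 2 * low_mean j * centered j n - low_mean j ^+ 2.
  by rewrite /centered; ring.
rewrite (eq_bigr _ (fun n _ => E n)) !big_split /= sumrN -mulr_sumr.
rewrite sum_centered mulr0 subr0 gerDl sumr_le0// => n _.
by rewrite oppr_le0 sqr_ge0.
Qed.

Lemma low_le j n : `|low j n| <= Num.sqrt (scale j * Q) / r.
Proof.
rewrite ler_pdivlMr// -ler_sqr ?nnegrE ?mulr_ge0 ?(ltW r_gt0) ?(ltW (sd_gt0 _))//.
rewrite sd2 exprMn real_normK ?num_real// /low; case: ifP => //= _.
by rewrite expr0n mul0r mulr_ge0 ?ltW// scale_gt0.
Qed.

Lemma centered_le j n : `|6 * rate j * centered j n| <= 1.
Proof.
have h : `|centered j n| <= 2 * (Num.sqrt (scale j * Q) / r).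
  rewrite /centered (le_trans (ler_normB _ _))// mulr2n mulrDl mul1r lerD ?low_le//.
  rewrite /low_mean normrM normfV (gtr0_norm NR) ler_pdivrMr//.
  rewrite (le_trans (ler_norm_sum _ _ _))// mulr_natr -[N in _ *+ N]card_ord -sumr_const.
  by rewrite ler_sum// => k _; exact: low_le.
have rt := rate_ge0 j.
rewrite normrM ger0_norm; last exact: mulr_ge0.
apply: (@le_trans _ _ (6 * rate j * (2 * (Num.sqrt (scale j * Q) / r)))).
  by apply: ler_wpM2l h; exact: mulr_ge0.
rewrite (_ : _ * _ = 1)// /rate; field.
by rewrite !gt_eqF.
Qed.

Lemma card_window j i p : (#|window j i p| <= 4 * 2 ^ j)%N.
Proof.
apply: (@leq_trans #|[set t : 'I_N | (i.+1 - 2 ^ j.+1 <= t < i + 2 ^ j.+1)%N]%SET|).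
  apply: subset_leq_card; apply/fintype.subsetP => t; rewrite !inE => /andP[/andP[h1 h2] _].
  by rewrite h2 andbT leq_subLR addnC.
rewrite card_ord_between expnS; lia.
Qed.

Lemma card_window_half j i p : (3 * #|window j i p| <= 2 * N)%N.
Proof.
have hN := odd_double_half N.
case: p.
  have : (#|window j i true| <= #|[set t : 'I_N | (0 <= t < N./2)%N]%SET|)%N.
    apply: subset_leq_card; apply/fintype.subsetP => t.
    by rewrite !inE => /andP[_ /eqP ->].
  rewrite card_ord_between; lia.
have : (#|window j i false| <= #|[set t : 'I_N | (N./2 <= t < N)%N]%SET|)%N.
  apply: subset_leq_card; apply/fintype.subsetP => t.
  by rewrite !inE ltn_ord andbT => /andP[_ /eqP tN]; rewrite leqNgt tN.
by rewrite card_ord_between; lia.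
Qed.

Lemma permE_excess j i p : permE (excess j i p) <= 8 * expR (r ^+ 2 / 2).
Proof.
have rt := rate_ge0 j.
apply: le_trans (permE_prefix_exp (Q := Q) _ _ _ _ _ _) _ => //.
- exact: ltnW.
- exact: card_window_half.
- exact: sum_centered.
- exact: sum_sqr_centered.
- exact: centered_le.
rewrite ler_wpM2l// ler_expR /rate expr_div_n exprMn sd2.
apply: (@le_trans _ _ (18 * (r ^+ 2 / (12 ^+ 2 * (scale j * Q))) * Q / N%:R * (4 * 2 ^+ j))).
  have sQ : 0 <= scale j * Q by rewrite mulr_ge0 ?ltW// scale_gt0.
  rewrite ler_wpM2l//.
    have h1 : 0 <= r ^+ 2 / (12 ^+ 2 * (scale j * Q)).
      by rewrite divr_ge0 ?sqr_ge0// mulr_ge0.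
    by rewrite divr_ge0 ?ler0n// mulr_ge0 ?(ltW Q0)// mulr_ge0.
  have -> : 4 * 2 ^+ j = (4 * 2 ^ j)%:R :> R by rewrite natrM natrX.
  by rewrite ler_nat card_window.
rewrite le_eqVlt; apply/orP; left; apply/eqP; rewrite /scale; field.
by rewrite !gt_eqF// exprn_gt0.
Qed.

(** A pointwise form of truncating y^2 at r^2: what exceeds r^2 is paid by an
    exponential moment. *)
Lemma sqr_le_expR (y : R) : 0 <= y ->
  y ^+ 2 <= r ^+ 2 + 4 * expR (- r ^+ 2) * expR (r * y).
Proof.
move=> y0; rewrite -mulrA -expRD.
have [yr|ry] := leP y r.
  apply: (@le_trans _ _ (r ^+ 2)); first by rewrite lerXn2r ?nnegrE// ltW.
  by rewrite lerDl mulr_ge0// expR_ge0.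
have -> : - r ^+ 2 + r * y = 2 * (r * (y - r) / 2) by field.
rewrite expRM_natl; set z := r * (y - r).
have z0 : 0 <= z by rewrite mulr_ge0 ?ltW// subr_gt0.
have : (1 + z / 2) ^+ 2 <= expR (z / 2) ^+ 2.
  by rewrite lerXn2r ?nnegrE ?expR_ge0 ?expR_ge1Dx// addr_ge0// divr_ge0.
have : (y - r) ^+ 2 <= z ^+ 2.
  by rewrite /z exprMn ler_peMl ?sqr_ge0// exprn_ege1.
have -> : y ^+ 2 = r ^+ 2 + ((y - r) ^+ 2 + 2 * z) by rewrite /z; ring.
rewrite lerD2l; set e := expR _ ^+ 2; set d := (y - r) ^+ 2; nra.
Qed.

Lemma prefix_sum_sqr_le j i p s (k : nat) : (k <= N)%N ->
  prefix_sum (centered j) (window j i p) s k ^+ 2 <=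
  144 * (scale j * Q) * (r ^+ 2 + 4 * expR (- r ^+ 2) * excess j i p s).
Proof.
move=> kN; have rt := rate_ge0 j.
have HN : (#|window j i p| < N)%N by have := card_window_half j i p; lia.
set x := prefix_sum _ _ _ _.
have := prefix_exp_ge (centered j) s (ltnW N1) HN rt kN; rewrite -/x -/(excess _ _ _ _) => h.
pose y := `|x| / (12 * Num.sqrt (scale j * Q)).
have y0 : 0 <= y by rewrite divr_ge0// mulr_ge0// ltW.
have -> : x ^+ 2 = 144 * (scale j * Q) * y ^+ 2.
  rewrite /y expr_div_n exprMn sd2 real_normK ?num_real//; field.
  by rewrite !gt_eqF// scale_gt0.
apply: ler_wpM2l; first by rewrite !mulr_ge0 ?(ltW Q0) ?(ltW (scale_gt0 _)).
apply: le_trans (sqr_le_expR y0) _; rewrite lerD2l.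
apply: ler_wpM2l; first by rewrite mulr_ge0 ?expR_ge0.
apply: le_trans h; rewrite ler_expR /y /rate le_eqVlt; apply/orP; left; apply/eqP.
by ring.
Qed.

(** An interval of length less than 2^(j+1) that contains i lies in the union of
    the two windows around i, and is a difference of two prefixes in each of them.
    The constant is 1152 = 4 * 2 * 144: the square of a sum of four terms is at
    most 4 times the sum of the squares, and each window gives two prefix sums,
    bounded by prefix_sum_sqr_le. *)
Lemma centered_interval_le j s (x y : nat) i : (x <= y)%N -> (y <= N)%N ->
  (x <= i < y)%N -> (y - x < 2 ^ j.+1)%N ->
  (\sum_(t in [set t : 'I_N | (x <= t < y)%N]%SET) centered j (s t)) ^+ 2 <=
  1152 * (scale j * Q) * (2 * r ^+ 2 +
    4 * expR (- r ^+ 2) * (excess j i true s + excess j i false s)).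
Proof.
move=> xy yN /andP[xi iy] yx.
pose P p k := prefix_sum (centered j) (window j i p) s k.
have E p : P p y - P p x =
    \sum_(t in [set t : 'I_N | (x <= t < y)%N]%SET | (t < N./2)%N == p) centered j (s t).
  rewrite /P /prefix_sum (bigID (fun t : 'I_N => (t < x)%N)) /=.
  rewrite (eq_bigl (mem (prefix (window j i p) x))); last first.
    move=> t; rewrite !inE; case: (ltnP t x) => tx; rewrite ?andbF// !andbT.
    by rewrite (leq_trans tx xy) andbT.
  rewrite addrAC subrr add0r; apply: eq_bigl => t; rewrite !inE -leqNgt.
  have [xt|tx] := leqP x t; rewrite ?andbF//= andbT.
  have [ty|yt] := ltnP t y; rewrite ?andbF//= andbT.
  by have -> : (i < t + 2 ^ j.+1)%N && (t < i + 2 ^ j.+1)%N by lia.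
rewrite (bigID (fun t : 'I_N => (t < N./2)%N)) /=.
rewrite (eq_bigl (fun t => (t \in [set t : 'I_N | (x <= t < y)%N]%SET) && ((t < N./2)%N == true)));
  last by move=> t; rewrite eqb_id.
rewrite -E.
rewrite (eq_bigl (fun t => (t \in [set t : 'I_N | (x <= t < y)%N]%SET) && ((t < N./2)%N == false)));
  last by move=> t; rewrite eqbF_neg.
rewrite -E.
have xN := leq_trans xy yN.
have := prefix_sum_sqr_le j i true s yN; have := prefix_sum_sqr_le j i true s xN.
have := prefix_sum_sqr_le j i false s yN; have := prefix_sum_sqr_le j i false s xN.
rewrite -!/(P _ _); set a := P _ _; set a' := P _ _; set d := P _ _; set d' := P _ _.
move: (scale j * Q) (4 * expR _) => K L.
set A := excess _ _ _ _; set B := excess _ _ _ _ => h1 h2 h3 h4.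
have := sqr_ge0 (d' + d); have := sqr_ge0 (a' + a).
have := sqr_ge0 (d' - d - (a' - a)); nra.
Qed.

(** The number of scales: the length of an interval is at most N. *)
Definition nscales := (trunc_log 2 N).+1.

(** The positions t and t' may belong to one interval of scale j. *)
Definition comparable_pos j t t' : bool := (t < t' + 2 ^ j.+1)%N && (t' < t + 2 ^ j.+1)%N.

(** The off-diagonal products of the high parts, over all scales. *)
Definition pair_excess s t t' : R :=
  \sum_(j < nscales | comparable_pos j t t') `|high j (s t)| * `|high j (s t')|.

(** The sum over all scales of scale j * (\sum_n |high j n|)^2. *)
Definition high_energy : R := \sum_(j < nscales) scale j * high_mass j ^+ 2.

(** The contribution of the position t to the bound for any interval that
    contains t. *)
Definition local_bound s t : R :=
  3 * (b (s t) ^+ 2 + \sum_(t' | t' != t) pair_excess s t t') +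
  3 / N%:R * (1152 * Q * (2 * r ^+ 2 + \sum_(j < nscales)
     4 * expR (- r ^+ 2) * (excess j t true s + excess j t false s))) +
  3 / N%:R * (2 * (\sum_i b i) ^+ 2 + 4 * high_energy).

Let pair_excess_ge0 s t t' : 0 <= pair_excess s t t'.
Proof. by apply: sumr_ge0 => j _; rewrite mulr_ge0. Qed.

Let excess2_ge0 j t s : 0 <= excess j t true s + excess j t false s.
Proof. by rewrite addr_ge0// /excess /prefix_exp addr_ge0 ?sqr_ge0. Qed.

Lemma high_le j n : `|high j n| <= `|b n|.
Proof. by rewrite /high; case: ifP => // _; rewrite normr0. Qed.

Lemma low_mean_sqr j : (N%:R * low_mean j) ^+ 2 <=
  2 * (\sum_i b i) ^+ 2 + 2 * high_mass j ^+ 2.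
Proof.
have -> : N%:R * low_mean j = \sum_i b i - \sum_i high j i.
  rewrite /low_mean mulrCA divff ?gt_eqF// mulr1 -sumrB.
  by apply: eq_bigr => i _; rewrite (low_high j i) addrC addKr.
have : (\sum_i high j i) ^+ 2 <= high_mass j ^+ 2.
  rewrite -(real_normK (num_real (\sum_i _))) lerXn2r ?nnegrE ?sumr_ge0//.
  exact: ler_norm_sum.
set S := \sum_i b i; set V := \sum_i _; have := sqr_ge0 (S + V); nra.
Qed.

(** The sum over I splits as A + D + M: high part, fluctuation of the low part,
    and mean of the low part. *)
Lemma interval_sum_le (I : {set 'I_N}) s : ord_interval I ->
  (\sum_(t in I) b (s t)) ^+ 2 <= \sum_(t in I) local_bound s t.
Proof.
move=> HI; have [->|[i0 i0I]] := set_0Vmem I.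
  by rewrite !big_set0 expr0n.
have [x [y [yN xy IE]]] := ord_intervalP HI i0I.
have cI : #|I| = (y - x)%N by rewrite IE card_ord_between (minn_idPl yN).
have cI0 : (0 < #|I|)%N by rewrite card_gt0; apply/set0Pn; exists i0.
have cIN : (#|I| <= N)%N by rewrite cI; lia.
pose j := trunc_log 2 #|I|.
have /andP[j1 j2] : (2 ^ j <= #|I| < 2 ^ j.+1)%N by apply: trunc_log_bounds.
have jN : (j < nscales)%N by rewrite ltnS leq_trunc_log.
have IR : (0 : R) < #|I|%:R by rewrite ltr0n.
have scI : scale j <= #|I|%:R / N%:R.
  by rewrite /scale ler_wpM2r ?invr_ge0 ?(ltW NR)// -natrX ler_nat.
have Isc : #|I|%:R / N%:R <= 2 * scale j.
  rewrite /scale mulrA -exprS ler_wpM2r ?invr_ge0 ?(ltW NR)// -natrX ler_nat.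
  exact: ltnW.
pose A := \sum_(t in I) high j (s t); pose D := \sum_(t in I) centered j (s t).
pose M := #|I|%:R * low_mean j.
have -> : \sum_(t in I) b (s t) = A + D + M.
  rewrite /A /D /M mulr_natl -sumr_const -!big_split /=; apply: eq_bigr => t _.
  by rewrite /centered -addrA subrK -low_high.
(* The pairs of positions of I are among the pairs counted by pair_excess. *)
have HA : A ^+ 2 <= \sum_(t in I) (b (s t) ^+ 2 + \sum_(t' | t' != t) pair_excess s t t').
  apply: (@le_trans _ _ ((\sum_(t in I) `|high j (s t)|) ^+ 2)).
    rewrite -(real_normK (num_real A)) lerXn2r ?nnegrE ?sumr_ge0//.
    exact: ler_norm_sum.
  rewrite expr2 mulr_suml; apply: ler_sum => t tI.
  rewrite mulr_sumr (bigD1 t)//= lerD//.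
    by rewrite -expr2 -[leRHS](real_normK (num_real _)) lerXn2r ?nnegrE// high_le.
  rewrite (eq_bigl (fun t' => (t' != t) && (t' \in I))); last by move=> t'; rewrite andbC.
  rewrite big_mkcondr /= ler_sum// => t' t't; case: ifP => // t'I.
  have jc : comparable_pos j t t'.
    have tt (x0 y0 m : nat) (u u' : nat) :
        (x0 <= u < y0)%N -> (x0 <= u' < y0)%N -> (y0 - x0 < m)%N -> (u < u' + m)%N.
      by clear; lia.
    move: tI t'I j2; rewrite cI IE !inE => tI t'I j2.
    by rewrite /comparable_pos !(tt x y).
  by rewrite /pair_excess (bigD1 (Ordinal jN))//= lerDl sumr_ge0.
(* The bound by the windows around t holds for every t in I: average over t. *)
have HD : D ^+ 2 <= \sum_(t in I) (1 / N%:R * (1152 * Q * (2 * r ^+ 2 + \sum_(j < nscales)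
     4 * expR (- r ^+ 2) * (excess j t true s + excess j t false s)))).
  rewrite -(ler_pM2l IR) [leLHS]mulr_natl -[leLHS]sumr_const [leRHS]mulr_sumr.
  apply: ler_sum => t tI.
  apply: (@le_trans _ _ (1152 * (scale j * Q) * (2 * r ^+ 2 +
      4 * expR (- r ^+ 2) * (excess j t true s + excess j t false s)))).
    rewrite /D IE; apply: centered_interval_le => //.
      by move: tI; rewrite IE inE.
    by rewrite -cI.
  set K1 := 2 * r ^+ 2 + _ * _; set K2 := 2 * r ^+ 2 + \sum_(_ < _) _.
  have K10 : 0 <= K1.
    apply: addr_ge0; first by apply: mulr_ge0; rewrite ?sqr_ge0.
    by apply: mulr_ge0 (excess2_ge0 _ _ _); apply: mulr_ge0; rewrite ?expR_ge0.
  have K12 : K1 <= K2.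
    rewrite /K1 /K2 lerD2l (bigD1 (Ordinal jN))//= lerDl sumr_ge0// => k _.
    by apply: mulr_ge0 (excess2_ge0 _ _ _); apply: mulr_ge0; rewrite ?expR_ge0.
  rewrite [leRHS](_ : _ = 1152 * (#|I|%:R / N%:R * Q * K2)); last by field; rewrite gt_eqF.
  rewrite -mulrA; apply: ler_wpM2l; first exact: ler0n.
  have sc0 := ltW (scale_gt0 j).
  apply: ler_pM K10 _ K12; first exact: mulr_ge0 sc0 (ltW Q0).
  exact: ler_wpM2r (ltW Q0) _ _ scI.
have HM : M ^+ 2 <= \sum_(t in I) (1 / N%:R * (2 * (\sum_i b i) ^+ 2 + 4 * high_energy)).
  rewrite sumr_const -[leRHS]mulr_natl.
  have -> : M ^+ 2 = #|I|%:R / N%:R * (#|I|%:R / N%:R * (N%:R * low_mean j) ^+ 2).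
    by rewrite /M; field; rewrite gt_eqF.
  rewrite [leRHS]mulrA div1r; apply: ler_wpM2l; first by rewrite divr_ge0 ?ltW.
  have q0 : 0 <= #|I|%:R / N%:R :> R by rewrite divr_ge0 ?ltW.
  have q1 : #|I|%:R / N%:R <= 1 :> R by rewrite ler_pdivrMr// mul1r ler_nat.
  apply: le_trans (ler_wpM2l q0 (low_mean_sqr j)) _; rewrite mulrDr lerD//.
    by rewrite ler_piMl// mulr_ge0// sqr_ge0.
  apply: (@le_trans _ _ (2 * scale j * (2 * high_mass j ^+ 2))).
    by rewrite ler_wpM2r// mulr_ge0// sqr_ge0.
  rewrite [leLHS](_ : _ = 4 * (scale j * high_mass j ^+ 2)); last by ring.
  rewrite ler_wpM2l// /high_energy (bigD1 (Ordinal jN))//= lerDl sumr_ge0// => k _.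
  by rewrite mulr_ge0 ?sqr_ge0// ltW// scale_gt0.
apply: (@le_trans _ _ (3 * A ^+ 2 + 3 * D ^+ 2 + 3 * M ^+ 2)).
  have := sqr_ge0 (A - D); have := sqr_ge0 (A - M); have := sqr_ge0 (D - M); nra.
rewrite /local_bound !big_split /= lerD ?lerD//.
- by apply: (le_trans (ler_wpM2l (ler0n _ 3) HA)); rewrite mulr_sumr.
- apply: (le_trans (ler_wpM2l (ler0n _ 3) HD)); rewrite mulr_sumr ler_sum// => t _.
  by rewrite !mulrA mulr1.
- apply: (le_trans (ler_wpM2l (ler0n _ 3) HM)); rewrite mulr_sumr ler_sum// => t _.
  by rewrite !mulrA mulr1.
Qed.

Definition variation_bound s : R := \sum_t local_bound s t.

Lemma variation_le (P : {set {set 'I_N}}) s : interval_partition P ->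
  \sum_(I in P) (\sum_(t in I) b (s t)) ^+ 2 <= variation_bound s.
Proof.
move=> /andP[/and3P[/eqP cP tP _] /forall_inP HP].
apply: (@le_trans _ _ (\sum_(I in P) \sum_(t in I) local_bound s t)).
  by apply: ler_sum => I /HP; exact: interval_sum_le.
rewrite -finset.big_trivIset//= cP /variation_bound le_eqVlt; apply/orP; left.
by apply/eqP/eq_bigl => t; rewrite inE.
Qed.

(** For a pair (n, n') the scales at which both values are high satisfy
    2^j < |b n| |b n'| r^2 N / Q, so that the sum over j is geometric. *)
Lemma high_energy_le : high_energy <= 2 * r ^+ 2 * Q.
Proof.
have r0 : 0 <= r := ltW r_gt0.
have key n n' : \sum_(j < nscales) scale j * (`|high j n| * `|high j n'|) <=
    2 * r ^+ 2 / Q * (b n ^+ 2 * b n' ^+ 2).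
  pose y := `|b n| * `|b n'| * r ^+ 2 * N%:R / Q.
  have y0 : 0 <= y by apply: divr_ge0; [rewrite !mulr_ge0 | exact: ltW].
  apply: (@le_trans _ _ (`|b n| * `|b n'| / N%:R * (\sum_(j < nscales | 2 ^+ j < y) 2 ^+ j))).
    rewrite mulr_sumr [leRHS]big_mkcond /= ler_sum// => j _.
    rewrite /high; case: ifPn => [_|hn]; first rewrite normr0 mul0r mulr0.
      by case: ifP => // _; rewrite !mulr_ge0// ?invr_ge0 ?(ltW NR)// exprn_ge0.
    case: ifPn => [_|hn']; first rewrite normr0 !mulr0.
      by case: ifP => // _; rewrite !mulr_ge0// ?invr_ge0 ?(ltW NR)// exprn_ge0.
    rewrite ifT; first by rewrite le_eqVlt; apply/orP; left; apply/eqP; rewrite /scale; ring.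
    rewrite /y ltr_pdivlMr// -ltr_pdivrMr//.
    rewrite -ltr_sqr ?nnegrE ?mulr_ge0// ?invr_ge0 ?(ltW NR) ?exprn_ge0 ?(ltW Q0)//.
    move: hn hn'; rewrite /light -!ltNge => hn hn'.
    have -> : 2 ^+ j * Q / N%:R = scale j * Q by rewrite /scale mulrAC.
    have sQ : 0 < scale j * Q by rewrite mulr_gt0// scale_gt0.
    have -> : (`|b n| * `|b n'| * r ^+ 2) ^+ 2 = (b n ^+ 2 * r ^+ 2) * (b n' ^+ 2 * r ^+ 2).
      by rewrite !exprMn !real_normK ?num_real//; ring.
    by rewrite expr2; apply: ltr_pM => //; exact: ltW.
  have yb := sum_pow2_lt nscales y0.
  apply: (@le_trans _ _ (`|b n| * `|b n'| / N%:R * (2 * y))).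
    by rewrite ler_wpM2l// divr_ge0 ?mulr_ge0// ltW.
  rewrite -(real_normK (num_real (b n))) -(real_normK (num_real (b n'))).
  rewrite le_eqVlt; apply/orP; left; apply/eqP; rewrite /y; field.
  by rewrite !gt_eqF.
have -> : high_energy = \sum_n \sum_n' \sum_(j < nscales)
    scale j * (`|high j n| * `|high j n'|).
  rewrite (eq_bigr (fun n => \sum_(j < nscales) \sum_n' scale j * (`|high j n| * `|high j n'|)));
    last by move=> n _; rewrite exchange_big.
  rewrite exchange_big; apply: eq_bigr => j _.
  rewrite expr2 mulr_suml mulr_sumr; apply: eq_bigr => n _.
  by rewrite mulr_sumr mulr_sumr.
apply: (@le_trans _ _ (\sum_n \sum_n' 2 * r ^+ 2 / Q * (b n ^+ 2 * b n' ^+ 2))).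
  by apply: ler_sum => n _; apply: ler_sum => n' _; exact: key.
have -> : \sum_n \sum_n' 2 * r ^+ 2 / Q * (b n ^+ 2 * b n' ^+ 2) =
    2 * r ^+ 2 / Q * (\sum_n b n ^+ 2) ^+ 2.
  set c := 2 * r ^+ 2 / Q; rewrite expr2 mulr_suml mulr_sumr.
  by apply: eq_bigr => n _; rewrite !mulr_sumr.
rewrite -!mulrA ler_wpM2l// ler_wpM2l// ler_wpM2l// ler_pdivrMl// -expr2.
rewrite lerXn2r// nnegrE ?(ltW Q0)//.
by rewrite sumr_ge0// => i _; exact: sqr_ge0.
Qed.

Lemma permE_pair_excess t t' : t' != t ->
  permE (fun s => pair_excess s t t') <=
  \sum_(j < nscales | comparable_pos j t t') (high_mass j / N%:R) ^+ 2.
Proof.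
move=> t't; rewrite /pair_excess permE_sum; apply: ler_sum => j _.
have := @permE_prod_le R N (fun n => `|high j n|) [set t; t']%SET (ltnW N1) (fun=> normr_ge0 _).
rewrite cards2 eq_sym t't mulrC; apply: le_trans; apply: ler_permE => s.
by rewrite big_setU1 ?inE 1?eq_sym// big_set1.
Qed.

Lemma permE_pairs : permE (fun s => \sum_t \sum_(t' | t' != t) pair_excess s t t') <=
  4 * high_energy.
Proof.
rewrite permE_sum.
apply: (@le_trans _ _ (\sum_t \sum_(j < nscales) (4 * 2 ^ j)%:R * (high_mass j / N%:R) ^+ 2)).
  apply: ler_sum => t _; rewrite permE_sum.
  apply: (@le_trans _ _ (\sum_(t' | t' != t)
    \sum_(j < nscales | comparable_pos j t t') (high_mass j / N%:R) ^+ 2)).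
    by apply: ler_sum => t' t't; exact: permE_pair_excess.
  apply: (@le_trans _ _ (\sum_t'
    \sum_(j < nscales | comparable_pos j t t') (high_mass j / N%:R) ^+ 2)).
    rewrite big_mkcond /=; apply: ler_sum => t' _; case: ifP => // _.
    by rewrite sumr_ge0// => j _; exact: sqr_ge0.
  rewrite (exchange_big_dep predT)//=; apply: ler_sum => j _.
  rewrite sumr_const -[leLHS]mulr_natl ler_wpM2r ?sqr_ge0// ler_nat.
  apply: (@leq_trans #|[set t' : 'I_N | (t.+1 - 2 ^ j.+1 <= t' < t + 2 ^ j.+1)%N]%SET|).
    apply: subset_leq_card; apply/fintype.subsetP => t'.
    rewrite !inE /comparable_pos unfold_in; lia.
  rewrite card_ord_between expnS; lia.
rewrite sumr_const card_ord -[leLHS]mulr_natl /high_energy !mulr_sumr ler_sum// => j _.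
rewrite natrM natrX /scale le_eqVlt; apply/orP; left; apply/eqP; field.
by rewrite gt_eqF.
Qed.

(** The last term comes from the excesses: its constant is
    48 * 48 * 96 = 3 * 1152 * 64. *)
Lemma permE_variation_bound : permE variation_bound <=
  6 * (\sum_i b i) ^+ 2 + 70 * 100 * r ^+ 2 * Q +
  48 * 48 * 96 * Q * nscales%:R * expR (- (r ^+ 2 / 2)).
Proof.
set E1 := fun s => \sum_t \sum_(t' | t' != t) pair_excess s t t'.
set E2 := fun s => \sum_t \sum_(j < nscales)
     4 * expR (- r ^+ 2) * (excess j t true s + excess j t false s).
have sc m (a : R) : \sum_(t < m) a = m%:R * a by rewrite sumr_const card_ord mulr_natl.
have vE s : variation_bound s = 3 * E1 s + (3 / N%:R * (1152 * Q)) * E2 s +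
    (3 * \sum_i b i ^+ 2 + 3 * (1152 * Q * (2 * r ^+ 2)) +
     3 * (2 * (\sum_i b i) ^+ 2 + 4 * high_energy)).
  rewrite /variation_bound /local_bound !big_split /= -!mulr_sumr !big_split /=.
  rewrite (sum_perm (fun n => b n ^+ 2)) !sc -/(E1 s) -/(E2 s).
  by field; rewrite gt_eqF.
rewrite (eq_permE vE) permED permE_cst permED permEZ (permEZ _ E2).
have E1le : permE E1 <= 4 * high_energy := permE_pairs.
have E2le : permE E2 <= N%:R * (nscales%:R * (64 * expR (- (r ^+ 2 / 2)))).
  rewrite /E2 permE_sum -[leRHS]sc; apply: ler_sum => t _.
  rewrite permE_sum -[leRHS]sc; apply: ler_sum => j _; rewrite permEZ permED.
  have h p := permE_excess j t p.
  have -> : expR (- (r ^+ 2 / 2)) = expR (- r ^+ 2) * expR (r ^+ 2 / 2).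
    by rewrite -expRD; congr expR; field.
  have := h true; have := h false; have := expR_ge0 (- r ^+ 2); nra.
have he := high_energy_le.
have E2le' : 3 / N%:R * (1152 * Q) * permE E2 <=
   48 * 48 * 96 * Q * nscales%:R * expR (- (r ^+ 2 / 2)).
  apply: le_trans (ler_wpM2l _ E2le) _.
    exact: mulr_ge0 (divr_ge0 (ler0n _ 3) (ltW NR)) (mulr_ge0 (ler0n _ _) (ltW Q0)).
  rewrite le_eqVlt; apply/orP; left; apply/eqP; field.
  by rewrite gt_eqF.
have r2 : Q <= r ^+ 2 * Q by rewrite ler_peMl ?(ltW Q0)// exprn_ege1.
have r20 : 0 <= r ^+ 2 * Q by apply: le_trans r2; exact: ltW.
have := bQ; lra.
Qed.

End VariationBound.

(** * The pointwise estimate for complex sequences *)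

Section Pointwise.
Context {R : realType} {N : nat}.
Implicit Types (s : {perm 'I_N}) (z : 'I_N -> R[i]) (P : {set {set 'I_N}}).

Lemma cmod_sqr (w : R[i]) : cmod w ^+ 2 = complex.Re w ^+ 2 + complex.Im w ^+ 2.
Proof. by case: w => x y /=; rewrite sqr_sqrtr// addr_ge0// sqr_ge0. Qed.

Lemma Re_sum (I : Type) (l : seq I) (p : pred I) (F : I -> R[i]) :
  complex.Re (\sum_(i <- l | p i) F i) = \sum_(i <- l | p i) complex.Re (F i).
Proof. by elim/big_rec2: _ => [//|i x y _ <-]; case: (F i) => ? ?; case: y. Qed.

Lemma Im_sum (I : Type) (l : seq I) (p : pred I) (F : I -> R[i]) :
  complex.Im (\sum_(i <- l | p i) F i) = \sum_(i <- l | p i) complex.Im (F i).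
Proof. by elim/big_rec2: _ => [//|i x y _ <-]; case: (F i) => ? ?; case: y. Qed.

(** The sum that a partition P contributes to the square of the V^2 norm, split
    into real and imaginary parts. *)
Definition partition_energy z P : R :=
  \sum_(I in P) ((\sum_(n in I) complex.Re (z n)) ^+ 2 + (\sum_(n in I) complex.Im (z n)) ^+ 2).

Lemma partition_energyE z P :
  \sum_(I in P) cmod (\sum_(n in I) z n) ^+ 2 = partition_energy z P.
Proof. by apply: eq_bigr => I _; rewrite cmod_sqr Re_sum Im_sum. Qed.

Lemma partition_energy_ge0 z P : 0 <= partition_energy z P.
Proof. by apply: sumr_ge0 => I _; rewrite addr_ge0// sqr_ge0. Qed.

Lemma interval_partition_trivial : (0 < N)%N ->
  interval_partition [set [set: 'I_N]%SET]%SET.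
Proof.
move=> N0; apply/andP; split.
  apply/and3P; split.
  - by rewrite finset.cover1.
  - by rewrite finset.trivIset1.
  - by rewrite inE; apply/eqP => /setP/(_ (Ordinal N0)); rewrite !inE.
apply/forall_inP => I; rewrite inE => /eqP ->.
apply/forall_inP => i _; apply/forall_inP => j _; apply/forallP => k.
by rewrite inE implybT.
Qed.

(** The supremum is a maximum over finitely many partitions; this form makes
    the V^2 norm visibly measurable. *)
Lemma V2norm_sqr z : (0 < N)%N -> V2norm z ^+ 2 =
  \big[Num.max/0]_(P : {set {set 'I_N}} | interval_partition P) partition_energy z P.
Proof.
move=> N0; rewrite /V2norm; set M := \big[_/_]_(_ | _) _; set E := image _ _.
have leM P : interval_partition P -> partition_energy z P <= M.
  by move=> HP; exact: le_bigmax_cond.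
have M0 : 0 <= M by exact: bigmax_ge_id.
have ubE : ubound E (Num.sqrt M).
  by move=> _ [P HP <-]; rewrite partition_energyE ler_wsqrtr// leM.
have [P HP PM] : exists2 P, interval_partition P & M = partition_energy z P.
  have [P HP PM] := eq_bigmax _ _ (partition_energy z) (interval_partition_trivial N0)
    (fun P _ => partition_energy_ge0 z P).
  by exists P.
suff -> : sup E = Num.sqrt M by rewrite sqr_sqrtr.
have EM : E (Num.sqrt M) by exists P => //; rewrite partition_energyE PM.
apply/eqP; rewrite eq_le; apply/andP; split.
  by apply: ge_sup => //; exists (Num.sqrt M).
by apply: ub_le_sup => //; exists (Num.sqrt M).
Qed.

(** The constant of permE_variation_lnln: 7000 * 2 from the main term of
    permE_variation_bound, and three times the constant of its last term. *)
Definition variation_const : R := 140 * 100 + 48 * 48 * 288.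

(* This makes ln (ln N) at least 1. *)
Hypothesis largeN : expR (expR 1) <= N%:R :> R.

Let L : R := ln (ln N%:R).

Let lnN_ge : expR 1 <= ln N%:R :> R.
Proof.
rewrite -[leLHS](@expRK R) ler_ln ?posrE ?expR_gt0//.
by rewrite (lt_le_trans _ largeN) ?expR_gt0.
Qed.

Lemma lnln_ge1 : 1 <= L.
Proof.
rewrite -[leLHS](@expRK R) ler_ln ?posrE ?expR_gt0//.
by rewrite (lt_le_trans _ lnN_ge) ?expR_gt0.
Qed.

Lemma largeN_gt1 : (1 < N)%N.
Proof.
rewrite -(ltr_nat R); apply: lt_le_trans largeN.
have e1 := expR_gt0 (1 : R).
have := expR_ge1Dx (expR 1 : R); lra.
Qed.

Lemma nscales_le : (@nscales N)%:R <= 3 * ln N%:R :> R.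
Proof.
have N0 : (0 < N)%N := ltnW largeN_gt1.
have e1 : 1 <= ln N%:R :> R.
  by apply: le_trans lnN_ge; have := expR_ge1Dx (1 : R); lra.
have /andP[tN _] := trunc_log_bounds (isT : (1 < 2)%N) N0.
have ln2 : 1 / 2 <= ln 2 :> R.
  rewrite -ler_expR lnK ?posrE//.
  have := expR_ge1Dx (- (1 / 2) : R); rewrite expRN => h.
  have e0 := expR_gt0 (1 / 2 : R).
  have : expR (1 / 2) * (1 + - (1 / 2)) <= expR (1 / 2) * (expR (1 / 2))^-1 :> R.
    by rewrite ler_wpM2l// ltW.
  by rewrite divff ?gt_eqF//; lra.
have : (trunc_log 2 N)%:R * ln 2 <= ln N%:R :> R.
  rewrite mulr_natl -lnXn ?posrE// ler_ln ?posrE ?exprn_gt0 ?ltr0n//.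
  by rewrite -natrX ler_nat.
rewrite /nscales -natr1.
have : (0 : R) <= (trunc_log 2 N)%:R by rewrite ler0n.
nra.
Qed.

(** The choice r^2 = 2 ln(ln N) makes exp(- r^2 / 2) = 1 / ln N compensate the
    number of scales. *)
Lemma permE_variation_lnln (b : 'I_N -> R) (Q : R) : 0 < Q -> \sum_i b i ^+ 2 <= Q ->
  permE (variation_bound b Q (Num.sqrt (2 * L))) <=
  6 * (\sum_i b i) ^+ 2 + variation_const * L * Q.
Proof.
move=> Q0 bQ; have L1 := lnln_ge1.
have r1 : 1 <= Num.sqrt (2 * L).
  by rewrite -[leLHS](sqrtr1 R) ler_wsqrtr//; lra.
apply: le_trans (permE_variation_bound largeN_gt1 Q0 bQ r1) _.
rewrite sqr_sqrtr; last by lra.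
have -> : 2 * L / 2 = L by field.
have l0 : 0 < ln N%:R :> R by apply: lt_le_trans lnN_ge; exact: expR_gt0.
rewrite expRN (_ : expR L = ln N%:R); last by rewrite lnK ?posrE.
have h : (@nscales N)%:R / ln N%:R <= 3 :> R by rewrite ler_pdivrMr// nscales_le.
have QL : Q <= L * Q by rewrite ler_peMl// ltW.
have : Q * ((@nscales N)%:R / ln N%:R) <= Q * 3 by rewrite ler_wpM2l// ltW.
rewrite /variation_const -!mulrA; move: (Q * (_ / _)) => X; lra.
Qed.

Lemma permE_V2norm_sqr z (Q : R) : 0 < Q -> \sum_n cmod (z n) ^+ 2 <= Q ->
  permE (fun s => V2norm (fun n => z (s n)) ^+ 2) <=
  6 * cmod (\sum_n z n) ^+ 2 + 2 * variation_const * L * Q.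
Proof.
move=> Q0 zQ; have L1 := lnln_ge1; have N1 := largeN_gt1.
have r1 : 1 <= Num.sqrt (2 * L).
  by rewrite -[leLHS](sqrtr1 R) ler_wsqrtr//; lra.
pose x n := complex.Re (z n); pose y n := complex.Im (z n).
have xQ : \sum_n x n ^+ 2 <= Q.
  by apply: le_trans zQ; apply: ler_sum => n _; rewrite cmod_sqr lerDl sqr_ge0.
have yQ : \sum_n y n ^+ 2 <= Q.
  by apply: le_trans zQ; apply: ler_sum => n _; rewrite cmod_sqr lerDr sqr_ge0.
apply: (@le_trans _ _ (permE (fun s => variation_bound x Q (Num.sqrt (2 * L)) s +
    variation_bound y Q (Num.sqrt (2 * L)) s))).
  apply: ler_permE => s; rewrite V2norm_sqr; last exact: ltnW.
  have le P : interval_partition P -> partition_energy (fun n => z (s n)) P <=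
      variation_bound x Q (Num.sqrt (2 * L)) s + variation_bound y Q (Num.sqrt (2 * L)) s.
    move=> HP; rewrite /partition_energy big_split /=.
    by rewrite lerD// variation_le.
  apply: bigmax_le => //; apply: le_trans (le _ (interval_partition_trivial (ltnW N1))).
  exact: partition_energy_ge0.
rewrite permED cmod_sqr Re_sum Im_sum.
have := permE_variation_lnln Q0 xQ; have := permE_variation_lnln Q0 yQ.
rewrite /x /y; set A := permE _; set B := permE _; lra.
Qed.

End Pointwise.

Local Open Scope classical_set_scope.
Local Open Scope ring_scope.

(** * Integration *)

Section Integration.
Context {d : measure_display} {T : measurableType d} {R : realType}.
Variables (mu : {measure set T -> \bar R}) (D : set T).
Hypotheses (mD : measurable D) (muD : mu D = 1%E).
Context {N : nat}.
Implicit Types (f : T -> R[i]) (g phi : 'I_N -> T -> R[i]) (a : 'I_N -> R[i]).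

Lemma measurable_bigmaxr (I : Type) (l : seq I) (p : pred I) (h : I -> T -> R) :
  (forall i, measurable_fun D (h i)) ->
  measurable_fun D (fun x => \big[Num.max/0]_(i <- l | p i) h i x).
Proof.
move=> mh; elim: l => [|i l IH].
  by under eq_fun do rewrite big_nil; exact: measurable_cst.
under eq_fun do rewrite big_cons.
by case: (p i) => //; exact: measurable_maxr.
Qed.

Lemma measurable_V2norm_sqr g : (0 < N)%N -> (forall n, complex_measurable D (g n)) ->
  measurable_fun D (fun x => V2norm (fun n => g n x) ^+ 2).
Proof.
move=> N0 mg; under eq_fun do rewrite V2norm_sqr//.
apply: measurable_bigmaxr => P; rewrite /partition_energy.
under eq_fun do rewrite big_mkcond.
apply: measurable_sum => I; case: (I \in P); last exact: measurable_cst.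
apply: measurable_funD; apply: measurable_funX;
  under eq_fun do rewrite big_mkcond;
  apply: measurable_sum => n; case: (n \in I); try exact: measurable_cst.
  exact: (mg n).1.
exact: (mg n).2.
Qed.

Lemma complex_measurableZ (c : R[i]) f : complex_measurable D f ->
  complex_measurable D (fun x => c * f x).
Proof.
case: c => c1 c2 [mR mI]; split.
  have -> : (fun x => complex.Re (Complex c1 c2 * f x)) =
      (fun x => c1 * complex.Re (f x) - c2 * complex.Im (f x)).
    by apply/funext => x; case: (f x).
  by apply: measurable_funB; apply: measurable_funM => //; exact: measurable_cst.
have -> : (fun x => complex.Im (Complex c1 c2 * f x)) =
    (fun x => c1 * complex.Im (f x) + c2 * complex.Re (f x)).
  by apply/funext => x; case: (f x).
by apply: measurable_funD; apply: measurable_funM => //; exact: measurable_cst.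
Qed.

Lemma cmodM (w z : R[i]) : cmod (w * z) = cmod w * cmod z.
Proof. exact: Normc.normcM. Qed.

Lemma cmod_sum_sqr (z : 'I_N -> R[i]) :
  cmod (\sum_n z n) ^+ 2 = \sum_m \sum_n complex.Re (z m * (z n)^*%C).
Proof.
rewrite cmod_sqr Re_sum Im_sum !expr2 !mulr_suml -big_split; apply: eq_bigr => m _.
rewrite !mulr_sumr -big_split; apply: eq_bigr => n _ /=.
by case: (z m) (z n) => x y [x' y'] /=; rewrite mulrN opprK.
Qed.

(** The Parseval identity; unimodularity makes all the products bounded, hence
    integrable. *)
Lemma integral_cmod_sum phi a : orthonormal_system mu D phi ->
  (forall n x, D x -> cmod (phi n x) = 1) ->
  (\int[mu]_(x in D) (cmod (\sum_n a n * phi n x) ^+ 2)%:E =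
   (\sum_n cmod (a n) ^+ 2)%:E)%E.
Proof.
move=> [phiL2 phiO] phi1.
pose u m n x := complex.Re (phi m x * (phi n x)^*%C).
pose v m n x := complex.Im (phi m x * (phi n x)^*%C).
have uE m n x : u m n x = complex.Re (phi m x) * complex.Re (phi n x) +
    complex.Im (phi m x) * complex.Im (phi n x).
  by rewrite /u; case: (phi m x) (phi n x) => p q [p' q'] /=; rewrite mulrN opprK.
have vE m n x : v m n x = complex.Im (phi m x) * complex.Re (phi n x) -
    complex.Re (phi m x) * complex.Im (phi n x).
  by rewrite /v; case: (phi m x) (phi n x) => p q [p' q'] /=; rewrite mulrN addrC.
have mu_fin : (mu D < +oo)%E by rewrite muD ltry.
have phiM n : complex_measurable D (phi n) := (phiL2 n).1.
have one n x : D x -> complex.Re (phi n x) ^+ 2 + complex.Im (phi n x) ^+ 2 = 1.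
  by move=> Dx; rewrite -cmod_sqr phi1// expr1n.
have bnd (h : T -> R) : measurable_fun D h -> (forall x, D x -> `|h x| <= 1) ->
    mu.-integrable D (EFin \o h).
  move=> mh h1; apply: measurable_bounded_integrable => //.
  exists 1; split; first exact: num_real.
  by move=> M M1 x Dx /=; apply: le_trans (ltW M1); exact: h1.
have iu m n : mu.-integrable D (EFin \o u m n).
  apply: bnd.
    rewrite (funext (uE m n)).
    by apply: measurable_funD; apply: measurable_funM;
      [exact: (phiM m).1|exact: (phiM n).1|exact: (phiM m).2|exact: (phiM n).2].
  move=> x Dx; rewrite uE; have := one m x Dx; have := one n x Dx.
  set p := complex.Re (phi m x); set q := complex.Im (phi m x).
  set p' := complex.Re (phi n x); set q' := complex.Im (phi n x) => h1 h2.
  have := sqr_ge0 (p - p'); have := sqr_ge0 (q - q').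
  have := sqr_ge0 (p + p'); have := sqr_ge0 (q + q') => k1 k2 k3 k4.
  by rewrite ler_norml; apply/andP; split; nra.
have iv m n : mu.-integrable D (EFin \o v m n).
  apply: bnd.
    rewrite (funext (vE m n)).
    by apply: measurable_funB; apply: measurable_funM;
      [exact: (phiM m).2|exact: (phiM n).1|exact: (phiM m).1|exact: (phiM n).2].
  move=> x Dx; rewrite vE; have := one m x Dx; have := one n x Dx.
  set p := complex.Re (phi m x); set q := complex.Im (phi m x).
  set p' := complex.Re (phi n x); set q' := complex.Im (phi n x) => h1 h2.
  have := sqr_ge0 (q - p'); have := sqr_ge0 (p - q').
  have := sqr_ge0 (q + p'); have := sqr_ge0 (p + q') => k1 k2 k3 k4.
  by rewrite ler_norml; apply/andP; split; nra.
have Iu m n : (\int[mu]_(x in D) (u m n x)%:E)%E = ((m == n)%:R)%R%:E :> \bar R.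
  have := phiO m n; rewrite /L2inner => /(congr1 (@complex.Re R)) /= H.
  rewrite -[LHS]fineK; last exact: integrable_fin_num (iu m n).
  apply: (congr1 EFin).
  by rewrite [LHS]H; case: (m == n).
have Iv m n : (\int[mu]_(x in D) (v m n x)%:E)%E = 0%R%:E :> \bar R.
  have := phiO m n; rewrite /L2inner => /(congr1 (@complex.Im R)) /= H.
  rewrite -[LHS]fineK; last exact: integrable_fin_num (iv m n).
  apply: (congr1 EFin).
  by rewrite [LHS]H; case: (m == n).
pose al m n := complex.Re (a m * (a n)^*%C).
pose be m n := - complex.Im (a m * (a n)^*%C).
have E x : (cmod (\sum_n a n * phi n x) ^+ 2)%:E =
    (\sum_m \sum_n ((al m n)%:E * (u m n x)%:E + (be m n)%:E * (v m n x)%:E))%E.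
  rewrite cmod_sum_sqr -sumEFin; apply: eq_bigr => m _.
  rewrite -sumEFin; apply: eq_bigr => n _; rewrite -!EFinM -EFinD; congr (_%:E).
  rewrite /al /be /u /v.
  case: (a m) (a n) (phi m x) (phi n x) => [a1 a2] [b1 b2] [c1 c2] [e1 e2] /=.
  by ring.
under eq_integral do rewrite E.
have iZu m n : mu.-integrable D (fun x => (al m n)%:E * (u m n x)%:E)%E.
  exact: (integrableZl mD _ (iu m n)).
have iZv m n : mu.-integrable D (fun x => (be m n)%:E * (v m n x)%:E)%E.
  exact: (integrableZl mD _ (iv m n)).
rewrite integral_sum//; last first.
  by move=> m; apply: integrable_sum => // n _; exact: integrableD.
rewrite -sumEFin; apply: eq_bigr => m _.
rewrite integral_sum//; last by move=> n; exact: integrableD.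
rewrite (bigD1 m)//= big1 ?adde0; last first.
  move=> n nm; rewrite integralD// integralZl//; last exact: iu.
  rewrite integralZl//; last exact: iv.
  by rewrite Iu Iv eq_sym (negbTE nm) !mule0 adde0.
rewrite integralD// integralZl//; last exact: iu.
rewrite integralZl//; last exact: iv.
rewrite Iu Iv eqxx mule0 adde0 mule1; congr (_%:E).
by rewrite /al cmod_sqr; case: (a m) => x y /=; rewrite mulrN opprK !expr2.
Qed.

End Integration.

Lemma V2norm0 (R : realType) (N : nat) : (0 < N)%N -> V2norm (fun _ : 'I_N => 0 : R[i]) = 0.
Proof.
move=> N0; apply/eqP; rewrite -sqrf_eq0 V2norm_sqr// eq_le bigmax_ge_id andbT.
apply: bigmax_le => // P _; rewrite /partition_energy big1// => I _.
by rewrite !big1// expr0n addr0.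
Qed.

Section Rearrangement.
Context {d : measure_display} {T : measurableType d} {R : realType}.
Variables (mu : {measure set T -> \bar R}) (D : set T).
Hypotheses (mD : measurable D) (muD : mu D = 1%E).
Context {N : nat}.
Hypothesis largeN : expR (expR 1) <= N%:R :> R.
Variables (phi : 'I_N -> T -> R[i]) (a : 'I_N -> R[i]).
Hypotheses (phiON : orthonormal_system mu D phi)
  (phi1 : forall n x, D x -> cmod (phi n x) = 1).

Let Q : R := \sum_n cmod (a n) ^+ 2.
Let L : R := ln (ln N%:R).
Let F (s : {perm 'I_N}) x : R := V2norm (fun n => a (s n) * phi (s n) x) ^+ 2.

(** The pointwise estimate integrated over D, with the factor N! of the average. *)
Lemma sum_integral_V2norm_sqr : 0 < Q ->
  (\sum_s \int[mu]_(x in D) (F s x)%:E <= ((N`!)%:R * ((6 + 2 * variation_const * L) * Q))%:E)%E.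
Proof.
move=> Q0; have N1 := largeN_gt1 largeN; have N0 := ltnW N1; have L1 := lnln_ge1 largeN.
have mF s : measurable_fun D (F s).
  apply: measurable_V2norm_sqr => // n; apply: complex_measurableZ.
  exact: (phiON.1 (s n)).1.
have mEF s : measurable_fun D (EFin \o F s) by exact/measurable_EFinP.
pose S x := cmod (\sum_n a n * phi n x) ^+ 2.
have mS : measurable_fun D S.
  rewrite (_ : S = fun x => complex.Re (\sum_n a n * phi n x) ^+ 2 +
      complex.Im (\sum_n a n * phi n x) ^+ 2); last first.
    by apply/funext => x; rewrite /S cmod_sqr.
  apply: measurable_funD; apply: measurable_funX.
    under eq_fun do rewrite Re_sum.
    by apply: measurable_sum => n; exact: (complex_measurableZ (a n) (phiON.1 n).1).1.
  under eq_fun do rewrite Im_sum.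
  by apply: measurable_sum => n; exact: (complex_measurableZ (a n) (phiON.1 n).1).2.
have f0 : (0 : R) < (N`!)%:R by rewrite ltr0n fact_gt0.
have K0 : (0 : R) <= variation_const by rewrite /variation_const; lra.
have c0 : 0 <= 2 * variation_const * L * Q.
  by rewrite mulr_ge0 ?(ltW Q0)// mulr_ge0 ?(le_trans ler01 L1)// mulr_ge0.
rewrite -(@ge0_integral_sum _ _ _ mu D mD _ (fun s => EFin \o F s))//; last first.
  by move=> s x _; rewrite lee_fin sqr_ge0.
apply: (@le_trans _ _ (\int[mu]_(x in D)
    ((N`!)%:R%:E * ((6 * S x)%:E + (2 * variation_const * L * Q)%:E)))%E).
  apply: ge0_le_integral => //.
  - by move=> x _; apply: sume_ge0 => s _; rewrite lee_fin sqr_ge0.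
  - exact: emeasurable_sum.
  - apply: emeasurable_funM; first exact: measurable_cst.
    apply: emeasurable_funD; last exact: measurable_cst.
    apply/measurable_EFinP; apply: measurable_funM => //.
  move=> x Dx; rewrite sumEFin -EFinD -EFinM lee_fin.
  have := @permE_V2norm_sqr R N largeN (fun n => a n * phi n x) Q Q0.
  rewrite /permE ler_pdivrMl//; apply.
  by apply: ler_sum => n _; rewrite cmodM phi1// mulr1.
have mS6 : measurable_fun D (fun x => (6 * S x)%:E).
  by apply/measurable_EFinP; apply: measurable_funM.
have S0 x : (0 <= (6 * S x)%:E)%E by rewrite lee_fin mulr_ge0// sqr_ge0.
rewrite ge0_integralZl//; last 2 first.
- apply: emeasurable_funD => //; exact: measurable_cst.
- by move=> x _; rewrite adde_ge0// lee_fin.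
rewrite ge0_integralD//.
rewrite integral_cst// muD mule1.
under eq_integral do rewrite EFinM.
rewrite ge0_integralZl//; last 2 first.
- exact/measurable_EFinP.
- by move=> x _; rewrite lee_fin sqr_ge0.
rewrite (integral_cmod_sum mD muD a phiON)// -/Q -!EFinM lee_fin.
by rewrite le_eqVlt; apply/orP; left; apply/eqP; ring.
Qed.

(** The rearrangement theorem on an arbitrary probability domain D. *)
Lemma exists_rearrangement : exists s : {perm 'I_N},
  (L2V2norm mu D (fun n x => (a (s n) * phi (s n) x)%R) <=
   (Num.sqrt (6 + 2 * variation_const) * Num.sqrt L * Num.sqrt Q)%R%:E)%E.
Proof.
have N1 := largeN_gt1 largeN; have N0 := ltnW N1; have L1 := lnln_ge1 largeN.
have Q_ge0 : 0 <= Q by apply: sumr_ge0 => n _; exact: sqr_ge0.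
have K0 : (0 : R) <= variation_const by rewrite /variation_const; lra.
have [Q0|Q0] := eqVneq Q 0.
  exists 1%g; rewrite /L2V2norm.
  have a0 n : a n = 0.
    apply/Normc.eq0_normc/eqP; rewrite -sqrf_eq0.
    by move/eqP: Q0; rewrite psumr_eq0 => [/allP/(_ n (mem_index_enum n))|? _]; rewrite ?sqr_ge0.
  rewrite integral0_eq; last first.
    move=> x _; under [X in V2norm X]eq_fun do rewrite a0 mul0r.
    by rewrite V2norm0// expr0n.
  by rewrite sqrte0 lee_fin !mulr_ge0.
have Qpos : 0 < Q by rewrite lt_def Q0.
pose I s := (\int[mu]_(x in D) (F s x)%:E)%E.
pose c := (6 + 2 * variation_const * L) * Q.
have I0 s : (0 <= I s)%E by apply: integral_ge0 => x _; rewrite lee_fin sqr_ge0.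
have f0 : (0 : R) < (N`!)%:R by rewrite ltr0n fact_gt0.
have [s Is] : exists s, (I s <= c%:E)%E.
  (* Otherwise every integral exceeds the average c. *)
  apply: contrapT => /forallNP H.
  have Hc s : (c%:E < I s)%E by rewrite ltNge; apply/negP; exact: H.
  have HI := sum_integral_V2norm_sqr Qpos.
  have Ifin s : I s \is a fin_num.
    rewrite ge0_fin_numE//; apply: le_lt_trans (ltry ((N`!)%:R * c)).
    apply: le_trans HI; rewrite (bigD1 s)//=; apply: leeDl.
    by apply: sume_ge0 => s' _; exact: I0.
  move: HI; rewrite (eq_bigr (fun s => (fine (I s))%:E)); last by move=> s _; rewrite fineK.
  rewrite sumEFin lee_fin -/c leNgt => /negP; apply.
  rewrite mulr_natl -card_Sn -sumr_const.
  apply: ltr_sum => [|s _]; last by rewrite -lte_fin fineK.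
  by apply/hasP; exists 1%g; rewrite ?mem_index_enum.
exists s; rewrite /L2V2norm -/(I s).
apply: (@le_trans _ _ (sqrte (((6 + 2 * variation_const) * L * Q)%:E))).
  rewrite lee_sqrt ?lee_fin//; last first.
    by rewrite mulr_ge0// mulr_ge0 ?(le_trans ler01 L1)// addr_ge0// mulr_ge0.
  apply: le_trans Is _; rewrite lee_fin /c ler_wpM2r//; have L1' : 1 <= L := L1; lra.
rewrite /= lee_fin sqrtrM ?sqrtrM//.
  by rewrite addr_ge0// mulr_ge0.
by rewrite mulr_ge0 ?(le_trans ler01 L1)// addr_ge0// mulr_ge0.
Qed.

End Rearrangement.

(** The completed measure extends the Borel one, so the two agree on [0, 1]. *)
Lemma lebesgue_unit_itv (R : realType) : lebesgue R `[0%R, 1%R] = 1%E.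
Proof.
have := @lebesgue_measure_itv R `[0%R, 1%R].
by rewrite /= lte_fin ltr01 sube0.
Qed.

Theorem theorem7 (R : realType) :
  exists (C : R) (N0 : nat), 0 < C /\
    forall N : nat, (N0 <= N)%N ->
    forall (phi : 'I_N -> R -> R[i]) (a : 'I_N -> R[i]),
      orthonormal_system (lebesgue R) `[0%R, 1%R] phi ->
      (forall n x, x \in `[0%R, 1%R] -> cmod (phi n x) = 1) ->
      exists pi : {perm 'I_N},
        (L2V2norm (lebesgue R) `[0%R, 1%R]
           (fun (n : 'I_N) (x : R) => (a (pi n) * phi (pi n) x)%R)
         <= (C * Num.sqrt (ln (ln N%:R))
               * Num.sqrt (\sum_(n < N) cmod (a n) ^+ 2))%R%:E)%E.
Proof.
exists (Num.sqrt (6 + 2 * variation_const)), (Num.truncn (expR (expR 1 : R))).+1; split.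
  by rewrite sqrtr_gt0 /variation_const; lra.
move=> N N0N phi a phiON phi1.
have largeN : expR (expR 1) <= N%:R :> R.
  apply: ltW; apply: lt_le_trans (truncnS_gt _) _.
  by rewrite ler_nat.
have phi1' n x : `[0, 1]%classic x -> cmod (phi n x) = 1.
  by move=> Dx; apply: phi1; rewrite inE.
apply: (exists_rearrangement _ (lebesgue_unit_itv R) largeN a phiON phi1').
by apply: sub_caratheodory; exact: measurable_itv.
Qed.
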